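(* Let $(N,\preceq,F)$ be a transitive-closed description of a simply dependent multimodal logic. Then the sequent calculus $\mathsf{G}_{(N,\preceq,F)}$ extended with the contraction and weakening rules is sound for the logic $\mathcal{L}_{(N,\preceq,F)}$ described by it: for every formula $A$, if the sequent $\;\Rightarrow A$ is derivable in this calculus then $A\in\mathcal{L}_{(N,\preceq,F)}$.
   Context: A description is a triple $(N,\preceq,F)$ where $N$ is a finite set of natural numbers, $\preceq$ is a partial order on $N$, and $F(i)$ (for $i\in N$) is the extension of modal logic $\mathsf{K}$ by some subset of $\mathsf{D}: \neg\Box\bot$, $\mathsf{T}: \Box A\to A$, $\mathsf{4}: \Box A\to\Box\Box A$; $\mathsf{KAx}\subseteq F(i)$ means $F(i)$ proves every theorem of $\mathsf{K}+\mathsf{Ax}$. The language has propositional variables, $\bot,\top,\neg,\land,\lor,\to$ and $\Box_i$ for $i\in N$. The logic $\mathcal{L}_{(N,\preceq,F)}$ is the smallest set of formulas containing the propositional tautologies, for each $i$ the axiom $\Box_i(A\to B)\to(\Box_iA\to\Box_iB)$ and the instances for $\Box_i$ of the extra axioms of $F(i)$, the axioms $\Box_jA\to\Box_iA$ whenever $i\preceq j$, and closed under modus ponens and necessitation for each $\Box_i$. The description is transitive-closed if $i\preceq j$ and $\mathsf{K4}\subseteq F(i)$ imply $\mathsf{K4}\subseteq F(j)$. Standing assumption of the paper: for all $i\preceq j$, $\mathsf{KD}\subseteq F(i)$ implies $\mathsf{KD}\subseteq F(j)$ and $\mathsf{KT}\subseteq F(i)$ implies $\mathsf{KT}\subseteq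 F(j)$. Notation: $\uparrow i=\{j\in N: i\preceq j\}$, $\uparrow^{4} i=\{j\in\uparrow i:\mathsf{K4}\subseteq F(j)\}$, $\uparrow^{\neg4}i=\uparrow i\setminus\uparrow^4 i$; for a multiset $\Gamma$, $\Box_j\Gamma=\{\Box_jB: B\in\Gamma\}$. Sequents $\Gamma\Rightarrow\Delta$ are pairs of finite multisets of formulas. Propositional calculus $\mathsf{G}$: initial sequents $\Gamma,p\Rightarrow p,\Delta$ ($p$ atomic), $\Gamma,\bot\Rightarrow\Delta$, $\Gamma\Rightarrow\top,\Delta$; rules: $\neg_L$ from $\Gamma\Rightarrow A,\Delta$ infer $\Gamma,\neg A\Rightarrow\Delta$; $\neg_R$ from $\Gamma,A\Rightarrow\Delta$ infer $\Gamma\Rightarrow\neg A,\Delta$; $\lor_L$ from $\Gamma,A\Rightarrow\Delta$ and $\Gamma,B\Rightarrow\Delta$ infer $\Gamma,A\lor B\Rightarrow\Delta$; $\lor_R$ from $\Gamma\Rightarrow A,B,\Delta$ infer $\Gamma\Rightarrow A\lor B,\Delta$; $\land_L$ from $\Gamma,A,B\Rightarrow\Delta$ infer $\Gamma,A\land B\Rightarrow\Delta$; $\land_R$ from $\Gamma\Rightarrow A,\Delta$ and $\Gamma\Rightarrow B,\Delta$ infer $\Gamma\Rightarrow A\land B,\Delta$; $\to_L$ from $\Gamma,B\Rightarrow\Delta$ and $\Gamma\Rightarrow A,\Delta$ infer $\Gamma,A\to B\Rightarrow\Delta$; $\to_R$ from $\Gamma,A\Rightarrow B,\Delta$ infer $\Gamma\Rightarrow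 A\to B,\Delta$. Contraction: from $\Gamma,A,A\Rightarrow\Delta$ infer $\Gamma,A\Rightarrow\Delta$ (and dually on the right); weakening: from $\Gamma\Rightarrow\Delta$ infer $\Gamma,A\Rightarrow\Delta$ and $\Gamma\Rightarrow A,\Delta$. $\mathsf{G}_{(N,\preceq,F)}$ is $\mathsf{G}$ plus, with $\Omega,\Xi,\Gamma_j,\Sigma_j$ arbitrary finite multisets: for every $i\in N$ the rule $\mathsf{k}_i$: from $\{\Box_j\Gamma_j,\Sigma_j: j\in\uparrow^4 i\},\{\Sigma_j: j\in\uparrow^{\neg4}i\}\Rightarrow A$ infer $\Omega,\{\Box_j\Gamma_j,\Box_j\Sigma_j: j\in\uparrow^4 i\},\{\Box_j\Sigma_j: j\in\uparrow^{\neg4}i\}\Rightarrow\Box_iA,\Xi$; for every $i$ with $\mathsf{KD}\subseteq F(i)$ the rule $\mathsf{d}_i$: the same but with premiss succedent empty and conclusion $\Omega,\{\Box_j\Gamma_j,\Box_j\Sigma_j: j\in\uparrow^4 i\},\{\Box_j\Sigma_j: j\in\uparrow^{\neg4}i\}\Rightarrow\Xi$; for every $i$ with $\mathsf{KT}\subseteq F(i)$ the rule $\mathsf{t}_i$: from $\Omega,\{\Sigma_j: j\in\uparrow i\}\Rightarrow\Xi$ infer $\Omega,\{\Box_j\Sigma_j: j\in\uparrow i\}\Rightarrow\Xi$. *)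

(* Defs.v *)
From HB Require Import structures.
From mathcomp Require Import all_boot.
From mathcomp Require Import finmap multiset.
From mathcomp Require Import boolp.

Set Implicit Arguments.
Unset Strict Implicit.
Unset Printing Implicit Defensive.

Local Open Scope mset_scope.

HB.instance Definition _ (K : choiceType) :=
  Monoid.isComLaw.Build {mset K} (@mset0 K) (@msetD K)
    (@msetDA K) (@msetDC K) (@mset0D K).

(* The boxes are indexed by I; the unimodal language is [form unit]. *)
Inductive form (I : Type) : Type :=
| Var of nat
| Bot
| Top
| Neg of form I
| And of form I & form I
| Or of form I & form I
| Imp of form I & form I
| Box of I & form I.

Arguments Var {I} _.
Arguments Bot {I}.
Arguments Top {I}.

HB.instance Definition _ (I : Type) := gen_eqMixin (form I).
HB.instance Definition _ (I : Type) := gen_choiceMixin (form I).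

(* [v] is only consulted on variables and boxed formulas, so a tautology is a
   substitution instance of a classical propositional tautology. *)
Fixpoint eval (I : Type) (v : form I -> bool) (A : form I) : bool :=
  match A with
  | Var _ | Box _ _ => v A
  | Bot => false
  | Top => true
  | Neg B => ~~ eval v B
  | And B C => eval v B && eval v C
  | Or B C => eval v B || eval v C
  | Imp B C => eval v B ==> eval v C
  end.

Definition tautology (I : Type) (A : form I) : Prop := forall v, eval v A.

(* The least normal logic containing the formulas in [Ax]; there is no
   substitution rule, so [Ax] must contain all intended instances. *)
Inductive normal_logic (I : Type) (Ax : form I -> Prop) : form I -> Prop :=
| nl_taut A : tautology A -> normal_logic Ax A
| nl_K i A B :
    normal_logic Ax (Imp (Box i (Imp A B)) (Imp (Box i A) (Box i B)))
| nl_ax A : Ax A -> normal_logic Ax A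
| nl_mp A B :
    normal_logic Ax (Imp A B) -> normal_logic Ax A -> normal_logic Ax B
| nl_nec i A : normal_logic Ax A -> normal_logic Ax (Box i A).

Inductive schema : Type := AxD | AxT | Ax4.

Inductive schema_instance (I : Type) (i : I) : schema -> form I -> Prop :=
| inst_D : schema_instance i AxD (Neg (Box i Bot))
| inst_T A : schema_instance i AxT (Imp (Box i A) A)
| inst_4 A : schema_instance i Ax4 (Imp (Box i A) (Box i (Box i A))).

Definition K_ext (S : schema -> Prop) : form unit -> Prop :=
  normal_logic (fun A => exists2 s, S s & schema_instance tt s A).

Record description := Description {
  ixset : {fset nat};
  prec : rel ixset;
  prec_refl : reflexive prec;
  prec_anti : antisymmetric prec;
  prec_trans : transitive prec;
  extra_axioms : ixset -> schema -> Prop }.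

Definition Flogic (D : description) (i : ixset D) : form unit -> Prop :=
  K_ext (extra_axioms i).

(* KAx ⊆ F(i), as an inclusion of sets of theorems: for instance KD ⊆ F(i)
   also holds when F(i) is KT. *)
Definition K_in_F (D : description) (s : schema) (i : ixset D) : Prop :=
  forall A : form unit, K_ext (fun s' => s' = s) A -> Flogic i A.

Definition upward_closed (D : description) (s : schema) : Prop :=
  forall i j : ixset D, prec i j -> K_in_F s i -> K_in_F s j.

Definition transitive_closed (D : description) : Prop := upward_closed D Ax4.

Definition logic (D : description) : form (ixset D) -> Prop :=
  normal_logic (fun A =>
    (exists i : ixset D, exists2 s, extra_axioms i s & schema_instance i s A)
    \/ (exists i j : ixset D, exists2 B,
          prec i j & A = Imp (Box j B) (Box i B))).

Definition up (D : description) (i : ixset D) : {set ixset D} :=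
  [set j | prec i j].

Definition up4 (D : description) (i : ixset D) : {set ixset D} :=
  [set j in up i | `[< K_in_F Ax4 j >]].

Definition upn4 (D : description) (i : ixset D) : {set ixset D} :=
  up i :\: up4 i.

Definition sequent (I : Type) : Type := {mset form I} * {mset form I}.

Notation "G ⇒ D" := (@pair {mset _} {mset _} G%mset D%mset)
  (at level 75, no associativity) : mset_scope.

(* A rule set relates a list of premisses to a conclusion. *)
Definition rules (I : Type) := seq (sequent I) -> sequent I -> Prop.

Definition rules_union (I : Type) (R1 R2 : rules I) : rules I :=
  fun ps c => R1 ps c \/ R2 ps c.

Inductive derivable (I : Type) (R : rules I) : sequent I -> Prop :=
| derive ps c :
    R ps c -> (forall p, p \in ps -> derivable R p) -> derivable R c.

Inductive G_prop (I : Type) : rules I :=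
| init_var Γ Δ p : G_prop [::] (Var p +` Γ ⇒ Var p +` Δ)
| init_bot Γ Δ : G_prop [::] (Bot +` Γ ⇒ Δ)
| init_top Γ Δ : G_prop [::] (Γ ⇒ Top +` Δ)
| neg_L Γ Δ A : G_prop [:: Γ ⇒ A +` Δ] (Neg A +` Γ ⇒ Δ)
| neg_R Γ Δ A : G_prop [:: A +` Γ ⇒ Δ] (Γ ⇒ Neg A +` Δ)
| or_L Γ Δ A B :
    G_prop [:: A +` Γ ⇒ Δ; B +` Γ ⇒ Δ] (Or A B +` Γ ⇒ Δ)
| or_R Γ Δ A B : G_prop [:: Γ ⇒ A +` (B +` Δ)] (Γ ⇒ Or A B +` Δ)
| and_L Γ Δ A B : G_prop [:: A +` (B +` Γ) ⇒ Δ] (And A B +` Γ ⇒ Δ)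
| and_R Γ Δ A B :
    G_prop [:: Γ ⇒ A +` Δ; Γ ⇒ B +` Δ] (Γ ⇒ And A B +` Δ)
| imp_L Γ Δ A B :
    G_prop [:: B +` Γ ⇒ Δ; Γ ⇒ A +` Δ] (Imp A B +` Γ ⇒ Δ)
| imp_R Γ Δ A B : G_prop [:: A +` Γ ⇒ B +` Δ] (Γ ⇒ Imp A B +` Δ).

Inductive con_weak (I : Type) : rules I :=
| con_L Γ Δ A : con_weak [:: A +` (A +` Γ) ⇒ Δ] (A +` Γ ⇒ Δ)
| con_R Γ Δ A : con_weak [:: Γ ⇒ A +` (A +` Δ)] (Γ ⇒ A +` Δ)
| weak_L Γ Δ A : con_weak [:: Γ ⇒ Δ] (A +` Γ ⇒ Δ)
| weak_R Γ Δ A : con_weak [:: Γ ⇒ Δ] (Γ ⇒ A +` Δ).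

Definition box_mset (I : Type) (j : I) (Γ : {mset form I}) : {mset form I} :=
  seq_mset [seq Box j B | B <- Γ].

Section ModalRules.

Variable D : description.
Let fm := form (ixset D).
Implicit Types (i : ixset D) (Γ Σ : ixset D -> {mset fm}).

(* Only the values of Γ on ↑⁴i and of Σ on ↑i matter. *)
Definition kd_premiss i Γ Σ : {mset fm} :=
  (\big[msetD/mset0]_(j in up4 i) (box_mset j (Γ j) `+` Σ j))
  `+` \big[msetD/mset0]_(j in upn4 i) Σ j.

Definition kd_conclusion i Γ Σ : {mset fm} :=
  (\big[msetD/mset0]_(j in up4 i) (box_mset j (Γ j) `+` box_mset j (Σ j)))
  `+` \big[msetD/mset0]_(j in upn4 i) box_mset j (Σ j).

Inductive G_modal : rules (ixset D) :=
| rule_k i Γ Σ Ω Ξ A :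
    G_modal [:: kd_premiss i Γ Σ ⇒ [mset A]]
            (Ω `+` kd_conclusion i Γ Σ ⇒ Box i A +` Ξ)
| rule_d i Γ Σ Ω Ξ :
    K_in_F AxD i ->
    G_modal [:: kd_premiss i Γ Σ ⇒ mset0] (Ω `+` kd_conclusion i Γ Σ ⇒ Ξ)
| rule_t i Σ Ω Ξ :
    K_in_F AxT i ->
    G_modal [:: Ω `+` \big[msetD/mset0]_(j in up i) Σ j ⇒ Ξ]
            (Ω `+` \big[msetD/mset0]_(j in up i) box_mset j (Σ j) ⇒ Ξ).

End ModalRules.

Definition G_calc (D : description) : rules (ixset D) :=
  rules_union (@G_prop (ixset D)) (@G_modal D).

(* Main.v *)
(** A sequent is read as: its succedent follows classically from its
    antecedent together with finitely many theorems of the logic.  A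
    modal rule then only needs that each premiss formula [X], boxed by [i]
    for [k_i] and [d_i], is implied in the logic by a conclusion formula:
    [Box j B -> Box i B] for [i ≼ j], and [Box j B -> Box j (Box j B) ->
    Box i (Box j B)] if moreover [4] holds at [j].  The inclusions [KAx ⊆ F(i)]
    become schemata of the multimodal logic by substitution. *)
Require Import Defs.
From mathcomp Require Import all_boot.
From mathcomp Require Import finmap multiset.
From mathcomp Require Import boolp.

Set Implicit Arguments.
Unset Strict Implicit.
Unset Printing Implicit Defensive.

Local Open Scope mset_scope.

Lemma forall_in_cons (T : eqType) (P : T -> Prop) (x : T) (r : seq T) :
  (forall y, y \in x :: r -> P y) <-> P x /\ (forall y, y \in r -> P y).
Proof.
split=> [Pr|[Px Pr] y]; last by rewrite inE => /predU1P[->|/Pr].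
by split=> [|y ry]; apply: Pr; rewrite inE ?eqxx // ry orbT.
Qed.

Lemma in_big_msetD (K : choiceType) (T : finType) (P : {pred T})
    (F : T -> {mset K}) (x : K) :
  reflect (exists2 j, P j & x \in F j) (x \in \big[msetD/mset0]_(j | P j) F j).
Proof.
apply: (iffP idP) => [|[j Pj xF]].
  elim/big_rec: _ => [|j M Pj IH]; first by rewrite in_mset0.
  by rewrite in_msetD => /orP[xF|/IH//]; exists j.
by rewrite (bigD1 j) //= in_msetD xF.
Qed.

Lemma in_box_mset (I : Type) (j : I) (M : {mset form I}) (X : form I) :
  reflect (exists2 B, B \in M & X = Box j B) (X \in box_mset j M).
Proof. by rewrite /box_mset (perm_mem (perm_eq_seq_mset _)); exact: mapP. Qed.

(** * Substitution across modal languages *)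

Section Substitution.

Variables (I J : Type) (s : nat -> form J) (f : I -> J).

(** Boxes are renamed along with variables: a constant [f] carries a unimodal theorem of F(i) to the
    box [i] of the multimodal language. *)
Fixpoint subst (A : form I) : form J :=
  match A with
  | Var n => s n
  | Bot => Bot
  | Top => Top
  | Neg B => Neg (subst B)
  | And B C => And (subst B) (subst C)
  | Or B C => Or (subst B) (subst C)
  | Imp B C => Imp (subst B) (subst C)
  | Box i B => Box (f i) (subst B)
  end.

Lemma eval_subst (v : form J -> bool) (A : form I) :
  eval v (subst A) = eval (fun B => eval v (subst B)) A.
Proof. by elim: A => //= [B ->|B -> C ->|B -> C ->|B -> C ->]. Qed.

Lemma normal_logic_subst (Ax : form I -> Prop) (Ax' : form J -> Prop)
    (A : form I) :
  (forall B, Ax B -> Ax' (subst B)) ->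
  normal_logic Ax A -> normal_logic Ax' (subst A).
Proof.
move=> sAx; elim=> {A} [A tA|i A B|A /sAx|A B _ sAB _|i A _].
- by apply: nl_taut => v; rewrite eval_subst.
- exact: nl_K.
- exact: nl_ax.
- exact: nl_mp.
- exact: nl_nec.
Qed.

End Substitution.

(** * Truth of sequents under a single valuation *)

Section Models.

Variable I : Type.
Implicit Types (v : form I -> bool) (A B : form I) (Γ Δ : {mset form I}).

Definition models v (S : sequent I) : Prop :=
  (forall B, B \in S.1 -> eval v B) -> exists2 B, B \in S.2 & eval v B.

Lemma models_consL v A Γ Δ :
  models v (A +` Γ ⇒ Δ) <-> (eval v A -> models v (Γ ⇒ Δ)).
Proof.
split=> [sA vA vΓ|sA vAΓ].
  by apply: sA => B; rewrite in_mset1D => /predU1P[->//|/vΓ].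
apply: sA => [|B ΓB]; apply: vAΓ; rewrite in_mset1D ?eqxx //.
by rewrite ΓB orbT.
Qed.

Lemma models_consR v A Γ Δ :
  models v (Γ ⇒ A +` Δ) <-> eval v A \/ models v (Γ ⇒ Δ).
Proof.
split=> [sA|[vA _|sΓ /sΓ[B ΔB vB]]].
- have [vA|/negP nvA] := boolP (eval v A); [by left|right => /sA[B]].
  by rewrite in_mset1D => /predU1P[->//|ΔB vB]; exists B.
- by exists A; rewrite // in_mset1D eqxx.
- by exists B; rewrite // in_mset1D ΔB orbT.
Qed.

Lemma models_propositional_rule v ps S :
  rules_union (@G_prop I) (@con_weak I) ps S ->
  (forall p, p \in ps -> models v p) -> models v S.
Proof.
(* As equalities these rewrite under the quantified premisses, leaving only the truth values of the
   principal formulas and the truth of the context. *)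
have consL A Γ Δ := propext (models_consL v A Γ Δ).
have consR A Γ Δ := propext (models_consR v A Γ Δ).
have consE p qs := propext (forall_in_cons (models v) p qs).
case=> [[Γ Δ n|Γ Δ|Γ Δ|Γ Δ A|Γ Δ A|Γ Δ A B|Γ Δ A B|Γ Δ A B|Γ Δ A B|Γ Δ A B
  |Γ Δ A B]|[Γ Δ A|Γ Δ A|Γ Δ A|Γ Δ A]]; rewrite ?consE !(consL, consR) /=;
  repeat match goal with |- context [eval v ?A] => case: (eval v A) => /= end;
  rewrite ?(trueE, falseE); tauto.
Qed.

End Models.

(** * Soundness of sequents for a normal logic *)

Section NormalLogic.

Variables (I : Type) (Ax : form I -> Prop).
Implicit Types (A B C X Y : form I) (s : seq (form I)).
Implicit Types (Γ Δ : {mset form I}).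

Let L := normal_logic Ax.

Lemma normal_logic_trans B A C : L (Imp A B) -> L (Imp B C) -> L (Imp A C).
Proof.
move=> LAB; apply: nl_mp; apply: nl_mp LAB; apply: nl_taut => v /=.
by case: (eval v A) (eval v B) (eval v C) => [] [] [].
Qed.

Lemma normal_logic_refl A : L (Imp A A).
Proof. by apply: nl_taut => v /=; apply: implybb. Qed.

Definition imps s A : form I := foldr (@Imp I) A s.

Lemma eval_imps (v : form I -> bool) s A :
  eval v (imps s A) = (all (eval v) s ==> eval v A).
Proof. by elim: s => //= B s ->; case: (eval v B). Qed.

Lemma normal_logic_imps s A : (forall B, B \in s -> L B) -> L (imps s A) -> L A.
Proof.
elim: s => //= B s IH Ls LA; apply: IH => [C sC|].
  by apply: Ls; rewrite inE sC orbT.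
by apply: nl_mp LA _; apply: Ls; rewrite mem_head.
Qed.

(** Axiom [K] is applied once for each antecedent in [s]. *)
Lemma normal_logic_box_imps i s A :
  L (Imp (Box i (imps s A)) (imps (map (Box i) s) (Box i A))).
Proof.
elim: s => [|B s IH] /=; first exact: normal_logic_refl.
apply: normal_logic_trans (nl_K _ _ _ _) _.
apply: nl_mp IH; apply: nl_taut => v /=.
by do 3!case: (eval _ _) || case: (v _).
Qed.

(** The list [s] is fixed before the valuation, so a single tautology [imps s A] suffices to extract
    a theorem [A] by modus ponens. *)
Definition sound (S : sequent I) : Prop :=
  exists2 s, (forall B, B \in s -> L B) &
    forall v, all (eval v) s -> models v S.

(** The theorem lists of the premisses are concatenated, so a rule valid at each valuation
    separately preserves soundness. *)
Lemma sound_of_models (ps : seq (sequent I)) (S : sequent I) :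
  (forall p, p \in ps -> sound p) ->
  (forall v, (forall p, p \in ps -> models v p) -> models v S) -> sound S.
Proof.
move=> sps psS.
suff [s Ls sS] : exists2 s, (forall B, B \in s -> L B) &
    forall v, all (eval v) s -> forall p, p \in ps -> models v p.
  by exists s => // v /sS /psS.
elim: ps sps {psS} => [|p ps IH] sps; first by exists [::].
have [s Ls sS] := IH (fun q pq => sps q (mem_behead (s := p :: ps) pq)).
have [t Lt tp] := sps p (mem_head _ _).
exists (s ++ t) => [B|v]; first by rewrite mem_cat => /orP[/Ls|/Lt].
rewrite all_cat => /andP[/sS sv /tp tv] q; rewrite inE => /predU1P[->//|].
exact: sv.
Qed.

Lemma sound_theorem A : sound (mset0 ⇒ [mset A]) <-> L A.
Proof.
split=> [[s Ls sA]|LA].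
  apply: (normal_logic_imps Ls); apply: nl_taut => v.
  rewrite eval_imps; apply/implyP => /sA[B|B]; first by rewrite in_mset0.
  by rewrite in_mset1 => /eqP ->.
exists [:: A] => [B|v /= /andP[vA _] _]; first by rewrite inE => /eqP ->.
by exists A; rewrite // in_mset1.
Qed.

(** One implication [Imp Y X] for each entry [X] of [Γ] joins the list of auxiliary theorems; there
    are finitely many. *)
Lemma sound_weaken_L Γ Γ' Δ :
  (forall X, X \in Γ -> exists2 Y, Y \in Γ' & L (Imp Y X)) ->
  sound (Γ ⇒ Δ) -> sound (Γ' ⇒ Δ).
Proof.
move=> ΓΓ' sΓ.
have [t Lt tΓ] : exists2 t, (forall B, B \in t -> L B) &
    forall v, all (eval v) t -> (forall Y, Y \in Γ' -> eval v Y) ->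
      forall X, X \in (Γ : seq _) -> eval v X.
  have : forall X, X \in (Γ : seq _) -> exists2 Y, Y \in Γ' & L (Imp Y X).
    by move=> X; apply: ΓΓ'.
  elim: (Γ : seq _) => [|X r IH] rΓ'; first by exists [::].
  have [t Lt tr] := IH (fun Y rY => rΓ' Y (mem_behead (s := X :: r) rY)).
  have [Y Γ'Y LYX] := rΓ' X (mem_head _ _).
  exists (Imp Y X :: t) => [B|v /= /andP[YX /tr tv] Γ'v Z].
    by rewrite inE => /predU1P[->//|/Lt].
  rewrite inE => /predU1P[->|]; last exact: tv.
  exact: implyP YX (Γ'v _ Γ'Y).
have [s Ls sΔ] := sΓ.
exists (s ++ t) => [B|v]; first by rewrite mem_cat => /orP[/Ls|/Lt].
rewrite all_cat => /andP[/sΔ sv /tΓ tv] /tv Γv; exact: sv.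
Qed.

(** The hypothesis on [Δ] covers both the succedent [[mset A]] of k and, with [A] equal to [Bot],
    the empty succedent of d. *)
Lemma sound_imps Γ Δ A :
  (forall v, (exists2 B, B \in Δ & eval v B) -> eval v A) ->
  sound (Γ ⇒ Δ) -> L (imps Γ A).
Proof.
move=> ΔA [s Ls sΔ]; apply: (normal_logic_imps Ls); apply: nl_taut => v.
rewrite !eval_imps; apply/implyP => /sΔ sv; apply/implyP => /allP Γv.
exact/ΔA/sv.
Qed.

(** Necessitation is applied to [imps Γ A], and the box is then distributed over the antecedents. *)
Lemma sound_box i Γ Δ A :
  (forall v, (exists2 B, B \in Δ & eval v B) -> eval v A) ->
  sound (Γ ⇒ Δ) -> sound (box_mset i Γ ⇒ [mset Box i A]).
Proof.
move=> ΔA /(sound_imps ΔA)/(nl_nec i)/(nl_mp (normal_logic_box_imps _ _ _)) LA.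
exists [:: imps (map (Box i) Γ) (Box i A)] => [B|v /=].
  by rewrite inE => /eqP ->.
rewrite andbT eval_imps => /implyP ΓA Γv.
exists (Box i A); first by rewrite in_mset1.
apply: ΓA; apply/allP => X /mapP[B ΓB ->]; apply: Γv.
by apply/in_box_mset; exists B.
Qed.

End NormalLogic.

(** * The modal rules over a description *)

Section Description.

Variable D : description.
Implicit Types (i j : ixset D) (A B X : form (ixset D)).

Definition logic_axiom A : Prop :=
  (exists i, exists2 s, extra_axioms i s & schema_instance i s A)
  \/ (exists i j, exists2 B, prec i j & A = Imp (Box j B) (Box i B)).

Lemma logic_prec i j B : prec i j -> logic (Imp (Box j B) (Box i B)).
Proof. by move=> ij; apply: nl_ax; right; exists i, j, B. Qed.

(** The schema [s] may be merely derivable in F(i), so the whole unimodal derivation of [C] is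
    translated; each axiom used becomes an instance of the same schema for the box [i]. *)
Lemma logic_schema i s (C : form unit) (σ : nat -> form (ixset D)) :
  K_in_F s i -> schema_instance tt s C -> logic (subst σ (fun=> i) C).
Proof.
move=> si sC; have : Flogic i C by apply/si/nl_ax; exists s.
apply: normal_logic_subst => B [s' s'i s'B]; left; exists i; exists s' => //.
by case: s' B / s'B {s'i} => *; constructor.
Qed.

Lemma logic_D i : K_in_F AxD i -> logic (Neg (Box i Bot)).
(* The axiom has no variables, so the substitution is arbitrary. *)
Proof. by move/(logic_schema (fun=> Bot))/(_ (inst_D tt)). Qed.

Lemma logic_T i A : K_in_F AxT i -> logic (Imp (Box i A) A).
Proof.
by move/(logic_schema (fun=> A))/(_ (inst_T _ (Var 0))).
Qed.

Lemma logic_4 i A : K_in_F Ax4 i -> logic (Imp (Box i A) (Box i (Box i A))).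
Proof.
by move/(logic_schema (fun=> A))/(_ (inst_4 _ (Var 0))).
Qed.

Lemma kd_premiss_boxed i (Γ Σ : ixset D -> {mset form (ixset D)}) X :
  X \in box_mset i (kd_premiss i Γ Σ) ->
  exists2 Y, Y \in kd_conclusion i Γ Σ & logic (Imp Y X).
Proof.
case/in_box_mset=> {}X + ->; rewrite /kd_premiss in_msetD.
case/orP=> /in_big_msetD[j].
- rewrite inE inE => /andP[ij /asboolP j4]; rewrite in_msetD => /orP[].
    (* Here [X] is [Box j B]: schema [4] is used at [j], before descending to [i]. *)
    case/in_box_mset=> B ΓB ->; exists (Box j B).
      rewrite in_msetD; apply/orP; left; apply/in_big_msetD; exists j.
        by rewrite !inE ij; apply/asboolP.
      by rewrite in_msetD; apply/orP; left; apply/in_box_mset; exists B.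
    exact: normal_logic_trans (logic_4 _ j4) (logic_prec _ ij).
  move=> ΣX; exists (Box j X); last exact: logic_prec.
  rewrite in_msetD; apply/orP; left; apply/in_big_msetD; exists j.
    by rewrite !inE ij; apply/asboolP.
  by rewrite in_msetD; apply/orP; right; apply/in_box_mset; exists X.
- move=> j4 ΣX; exists (Box j X).
    rewrite in_msetD; apply/orP; right; apply/in_big_msetD; exists j => //.
    by apply/in_box_mset; exists X.
  by apply: logic_prec; move: j4; rewrite !inE => /andP[].
Qed.

Lemma sound_G_modal ps S :
  G_modal ps S -> (forall p, p \in ps -> sound logic_axiom p) ->
  sound logic_axiom S.
Proof.
(* Shared by k and d: the boxed premiss antecedent is traded for that of the conclusion, and [Ω] is
   added. *)
have kdP i Γ Σ Ω Δ : sound logic_axiom (box_mset i (kd_premiss i Γ Σ) ⇒ Δ) ->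
    sound logic_axiom (Ω `+` kd_conclusion i Γ Σ ⇒ Δ).
  apply: sound_weaken_L => X /kd_premiss_boxed[Y cY LYX].
  by exists Y; rewrite // in_msetD cY orbT.
case=> {ps S} [i Γ Σ Ω Ξ A|i Γ Σ Ω Ξ iD|i Σ Ω Ξ iT] /(_ _ (mem_head _ _)).
- move/(@sound_box _ _ i _ _ A) => sA.
  have /sA/kdP : forall v, (exists2 B, B \in [mset A] & eval v B) -> eval v A.
    by move=> v [B]; rewrite in_mset1 => /eqP ->.
  move/(_ Ω) => sΩ.
  apply: (sound_of_models (ps := [:: _])) => [p|v /(_ _ (mem_head _ _)) vΩ].
    by rewrite inE => /eqP ->; exact: sΩ.
  move=> /vΩ[B]; rewrite in_mset1 => /eqP -> vA; exists (Box i A) => //.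
  by rewrite in_mset1D eqxx.
(* Boxing the empty succedent yields [Box i Bot], which the theorem [Neg (Box i Bot)] refutes; any
   [Ξ] then follows. *)
- move/(@sound_box _ _ i _ _ Bot) => sA.
  have /sA/kdP : forall v : form (ixset D) -> bool,
      (exists2 B, B \in mset0 & eval v B) -> eval v Bot.
    by move=> v [B]; rewrite in_mset0.
  have sD := (sound_theorem _ _).2 (logic_D iD).
  move/(_ Ω) => sΩ; apply: (sound_of_models (ps := [:: _; _])) => [p|v sv].
    by rewrite !inE => /orP[]/eqP ->; [exact: sΩ|exact: sD].
  have [|B] := sv _ (mem_last _ [:: _]); first by move=> B; rewrite in_mset0.
  rewrite in_mset1 => /eqP -> /= /negP nv /(sv _ (mem_head _ _))[B'].
  by rewrite in_mset1 => /eqP ->.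
(* For t the premiss is not boxed: [Box j X] implies [Box i X], which implies [X] by [T] at [i]. *)
- apply: sound_weaken_L => X; rewrite in_msetD => /orP[ΩX|/in_big_msetD[j]].
    by exists X; [rewrite in_msetD ΩX|exact: normal_logic_refl].
  rewrite inE => ij ΣX; exists (Box j X).
    rewrite in_msetD; apply/orP; right; apply/in_big_msetD; exists j.
      by rewrite inE.
    by apply/in_box_mset; exists X.
  exact: normal_logic_trans (logic_prec _ ij) (logic_T _ iT).
Qed.

Lemma sound_derivable S :
  derivable (rules_union (@G_calc D) (@con_weak (ixset D))) S ->
  sound logic_axiom S.
Proof.
elim=> {S} ps S psS _ IH.
case: psS => [[psS|psS]|psS]; last 1 first.
- apply: (sound_of_models IH) => v; exact: (models_propositional_rule (or_intror psS)).
- apply: (sound_of_models IH) => v; exact: (models_propositional_rule (or_introl psS)).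
- exact: sound_G_modal psS IH.
Qed.

End Description.

Theorem mainTheorem2 (D : description)
  (hD : upward_closed D AxD) (hT : upward_closed D AxT)
  (h4 : transitive_closed D) (A : form (ixset D)) :
  derivable (rules_union (@G_calc D) (@con_weak (ixset D)))
    (mset0 ⇒ [mset A]) ->
  logic A.
Proof. by move/sound_derivable/sound_theorem. Qed.
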